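(* Let $\varphi\in L^2_{\mathrm{loc}}(\mathbb{R}_+)$. The following are equivalent: (i) $Q_\varphi$ is bounded on $L^2(\mathbb{R}_+)$; (ii) $Q^+_\varphi$ is bounded on $L^2(\mathbb{R}_+)$; (iii) $\varphi\in X_\infty$.
   Context: $\mathbb{R}_+=(0,\infty)$, and ''loc'' refers to compact subsets of $(0,\infty)$. For a locally integrable complex-valued function $\varphi$ on $\mathbb{R}_+$, the operators $Q_\varphi$ and $Q_\varphi^+$ are defined on bounded functions $f$ with compact support in $\mathbb{R}_+$ by $$(Q_\varphi f)(x)=\int_0^\infty\varphi(\max\{x,y\})f(y)\,dy,\qquad (Q^+_\varphi f)(x)=\varphi(x)\int_0^x f(y)\,dy .$$ Such an operator is called bounded on $L^2(\mathbb{R}_+)$ if it extends to a bounded operator on $L^2(\mathbb{R}_+)$. $X_\infty$ is the space of all measurable functions $\varphi$ on $\mathbb{R}_+$ such that $\sup_{n\in\mathbb{Z}}2^n\int_{2^n}^{2^{n+1}}|\varphi(x)|^2\,dx<\infty$ (equivalently, $\sup_{x>0}x\int_x^\infty|\varphi(y)|^2\,dy<\infty$). *)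

(* Defs.v *)
From mathcomp Require Import all_boot all_order all_algebra.
From mathcomp Require Import all_classical all_reals all_analysis.
From mathcomp Require Import complex.
Import Order.TTheory GRing.Theory Num.Theory.
Import numFieldNormedType.Exports.
Import ComplexField.Normc.

Set Implicit Arguments.
Unset Strict Implicit.
Unset Printing Implicit Defensive.

Local Open Scope classical_set_scope.
Local Open Scope ring_scope.
Local Open Scope complex_scope.

(* Functions on (0, +oo) are represented by total functions R -> R[i]; every
   notion below depends only on the restriction to Rpos. *)
Definition Rpos (R : realType) : set R := [set x | 0 < x].
Arguments Rpos {R}.

(* Borel measurability of f : D -> C = R^2; every Lebesgue measurable function
   agrees a.e. with such an f, so the classes modulo a.e. equality are the usual
   ones. *)
Definition cmeasurable (R : realType) (D : set R) (f : R -> R[i]) : Prop :=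
  measurable_fun D (fun x => complex.Re (f x)) /\
  measurable_fun D (fun x => complex.Im (f x)).

Definition cintegral (R : realType) (D : set R) (f : R -> R[i]) : R[i] :=
  (\int[lebesgue_measure]_(x in D) complex.Re (f x)) +i*
  (\int[lebesgue_measure]_(x in D) complex.Im (f x)).

Definition integral_sq (R : realType) (D : set R) (f : R -> R[i]) : \bar R :=
  (\int[lebesgue_measure]_(x in D) ((normc (f x)) ^+ 2)%:E)%E.

Definition L2loc (R : realType) (f : R -> R[i]) : Prop :=
  cmeasurable Rpos f /\
  forall K : set R, compact K -> K `<=` Rpos -> (integral_sq K f < +oo)%E.

Definition L2norm (R : realType) (f : R -> R[i]) : \bar R :=
  'N[lebesgue_measure]_2%:E [(fun x => (normc (f x))%:E) \_ Rpos].

Definition inL2 (R : realType) (f : R -> R[i]) : Prop :=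
  cmeasurable Rpos f /\ (L2norm f < +oo)%E.

(* Bounded functions with compact support in Rpos. *)
Definition test_fun (R : realType) (f : R -> R[i]) : Prop :=
  [/\ cmeasurable Rpos f,
      exists M : R, forall x, 0 < x -> normc (f x) <= M &
      exists2 K : set R, compact K /\ K `<=` Rpos &
        forall x, 0 < x -> ~ K x -> f x = 0].

Definition Q (R : realType) (phi f : R -> R[i]) (x : R) : R[i] :=
  cintegral Rpos (fun y => phi (Num.max x y) * f y).

Definition Qplus (R : realType) (phi f : R -> R[i]) (x : R) : R[i] :=
  phi x * cintegral `]0, x[ f.

(* A bounded linear operator on the space of a.e.-classes, given by its action
   on representatives. *)
Definition L2_bounded_operator (R : realType)
    (T : (R -> R[i]) -> (R -> R[i])) : Prop :=
  [/\ forall f, inL2 f -> inL2 (T f),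
      forall f g, inL2 f -> inL2 g ->
        ae_eq lebesgue_measure Rpos f g ->
        ae_eq lebesgue_measure Rpos (T f) (T g),
      forall (a : R[i]) f g, inL2 f -> inL2 g ->
        ae_eq lebesgue_measure Rpos
          (T (fun x => a * f x + g x)) (fun x => a * T f x + T g x) &
      exists C : R, forall f, inL2 f -> (L2norm (T f) <= C%:E * L2norm f)%E].

(* A, meaningful only on test functions, extends to a bounded operator T. *)
Definition bounded_on_L2 (R : realType)
    (A : (R -> R[i]) -> (R -> R[i])) : Prop :=
  exists2 T, L2_bounded_operator T &
    forall f, test_fun f -> ae_eq lebesgue_measure Rpos (T f) (A f).

Definition Xinfty (R : realType) (phi : R -> R[i]) : Prop :=
  cmeasurable Rpos phi /\
  (ereal_sup (range (fun n : int =>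
     ((2 : R) ^ n)%:E * integral_sq `]((2 : R) ^ n), ((2 : R) ^ (n + 1))[ phi))
   < +oo)%E.

(* Main.v *)
Require Import Defs.
From mathcomp Require Import all_boot all_order all_algebra.
From mathcomp Require Import all_classical all_reals all_analysis.
From mathcomp Require Import complex.
From mathcomp Require Import measurable_realfun.
From mathcomp Require Import ring lra.
Import Order.TTheory GRing.Theory Num.Theory.
Import numFieldNormedType.Exports.
Import ComplexField.Normc.

Set Implicit Arguments.
Unset Strict Implicit.
Unset Printing Implicit Defensive.

Local Open Scope classical_set_scope.
Local Open Scope ring_scope.
Local Open Scope complex_scope.

(** Write u = |phi|.  Everything is governed by the tail condition
      y * \int_y^oo u^2 <= A  for all y > 0,
    which is the continuous form of the dyadic condition defining X_infty: a
    half-line is a union of dyadic shells whose bounds form a geometric series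
    (tail_bound_of_Xinfty, Xinfty_of_tail_bound).

    Necessity.  On the indicator f of [b/2, b] both operators take the value
    phi(x) * b/2 at every x > b, because there max(x, y) = x on the whole
    support of f.  Boundedness therefore gives
      (b/2)^2 \int_b^oo u^2 <= C^2 * b/2,
    which is the tail condition with A = 2 C^2 (tail_bound_of_bounded).  This
    single argument serves (i) and (ii) alike.

    Sufficiency.  Both operators have a kernel dominated by u(max(x, y)), so it
    is enough to bound the positive operator with that kernel.  This is a Schur
    test with a splitting u(max(x, y))^2 <= p(x, y) * p(y, x), where
      p(x, y) = (x y)^(-1/2)        for y < x,
      p(x, y) = u(y)^2 (x y)^(1/2)  for x < y.
    Cauchy-Schwarz in y and Tonelli reduce the L2 bound to
    \int p(x, y) dy <= 4 + 4 A.  The part y < x is \int_0^x y^(-1/2) dy; the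
    part y > x is \int_x^oo u(y)^2 y^(1/2) dy, which the tail condition controls
    by O(A x^(-1/2)) through a sum over the shells x 4^k <= y < x 4^(k+1).
    The tail condition also places y |-> u(max(x, y)) in L2 for each x > 0, so the
    defining integrals converge absolutely at every point for every f in L2:
    the kernel formula itself is the bounded extension, with no density
    argument (kernel_operator_bounded). *)

(** * Cauchy-Schwarz and sums over shells *)

Lemma poweR2E (R : realType) (x : \bar R) : (0 <= x -> x `^ 2 = x ^+ 2)%E.
Proof.
case: x => [r||//].
  by rewrite lee_fin => r0; rewrite poweR_EFin powR_mulrn// EFin_expe.
by rewrite poweRyr ?pnatr_eq0// expe2 mulyy.
Qed.

Section measure_tools.
Context d (T : measurableType d) (R : realType).
Variable mu : {measure set T -> \bar R}.
Local Open Scope ereal_scope.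

Lemma cauchy_schwarz_integral (D : set T) (f g : T -> R) : measurable D ->
  measurable_fun D f -> measurable_fun D g ->
  (\int[mu]_(x in D) (`|f x * g x|)%:E) ^+ 2 <=
  (\int[mu]_(x in D) (f x ^+ 2)%:E) * (\int[mu]_(x in D) (g x ^+ 2)%:E).
Proof.
move=> mD mf mg.
have sqE (h : T -> R) :
    'N[mu]_2%:E[EFin \o (h \_ D)] ^+ 2 = \int[mu]_(x in D) (h x ^+ 2)%:E.
  rewrite -poweR2E; [|exact: Lnorm_ge0..].
  rewrite [LHS](@poweR_Lnorm _ _ _ mu _ 2); last by rewrite pnatr_eq0.
  rewrite [RHS]integral_mkcond; apply: eq_integral => x _; rewrite /patch /=.
  case: (x \in D); first by rewrite powR_mulrn// real_normK// num_real.
  by rewrite (_ : point = 0%R :> R)// normr0 powR0// pnatr_eq0.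
have := @hoelder _ T R mu (f \_ D) (g \_ D) 2 2.
move=> /(_ ((measurable_restrictT _ mD).1 mf) ((measurable_restrictT _ mD).1 mg)).
move=> /(_ (ltr0Sn R 1) (ltr0Sn R 1)) h.
have {h} : 'N[mu]_1[EFin \o (f \_ D \* g \_ D)%R] <=
     'N[mu]_2%:E[EFin \o (f \_ D)] * 'N[mu]_2%:E[EFin \o (g \_ D)].
  by apply: h; field.
rewrite Lnorm1 => h.
have -> : \int[mu]_(x in D) (`|f x * g x|)%:E =
          \int[mu]_x `|(EFin \o (f \_ D \* g \_ D)%R) x|.
  rewrite [LHS]integral_mkcond; apply: eq_integral => x _ /=.
  rewrite /patch /=; case: (x \in D) => //.
  by rewrite (_ : point = 0%R :> R)// mulr0 normr0.
rewrite -!sqE !expe2 muleACA.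
by apply: lee_pmul => //; exact: integral_ge0.
Qed.

(** Geometric decay along a cover sums to twice the first bound; overlaps of the
    F k are harmless because the integrand is nonnegative. *)
Lemma ge0_integral_bigcup_geometric (F : (set T)^nat) (g : T -> \bar R) (c : R) :
  (forall k, measurable (F k)) -> measurable_fun (\bigcup_k F k : set T) g ->
  (forall x, (\bigcup_k F k) x -> 0 <= g x) ->
  (forall k, \int[mu]_(x in F k) g x <= (c / 2 ^+ k)%:E) ->
  \int[mu]_(x in \bigcup_k F k) g x <= (2 * c)%:E.
Proof.
move=> mF mg g0 Fc.
have sub k : seqDU F k `<=` F k by exact: subDsetl.
have msub k : measurable (seqDU F k) by apply: measurableD => //; apply: bigsetU_measurable.
move: (mg) (g0); rewrite seqDU_bigcup_eq => mg' g0'.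
rewrite ge0_integral_bigcup//.
have -> : (2 * c)%:E = \sum_(k <oo) (c / 2 ^+ k)%:E.
  symmetry; apply/cvg_lim => //.
  have := @cvg_geometric_series R c 2^-1; rewrite ger0_norm ?invr_ge0//.
  rewrite invf_lt1// ltr1n => /(_ isT) h.
  have -> : (fun n : nat => \sum_(0 <= k < n) (c / 2 ^+ k)%:E) =
            EFin \o series (geometric c 2^-1).
    apply/funext => n /=; rewrite /series/= sumEFin.
    by congr EFin; apply: eq_bigr => k _; rewrite exprVn.
  apply: cvg_EFin; first exact: nearW.
  have -> : (2 * c = c * (1 - 2^-1)^-1)%R by field.
  exact: h.
apply: lee_nneseries => [k _ _|k _].
  apply: integral_ge0 => x Fx; apply: g0'; exists k => //.
apply: le_trans (Fc k); apply: ge0_subset_integral => //.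
  apply: measurable_funS mg => //; first exact: bigcup_measurable.
  by move=> x Fx; exists k.
by move=> x Fx; apply: g0; exists k.
Qed.
End measure_tools.

(** * Tonelli on a rectangle and the Schur test *)

Section product_domain.
Context d1 d2 (T1 : measurableType d1) (T2 : measurableType d2) (R : realType).
Variable m1 : {sigma_finite_measure set T1 -> \bar R}.
Variable m2 : {sigma_finite_measure set T2 -> \bar R}.
Variables (D1 : set T1) (D2 : set T2).
Hypotheses (mD1 : measurable D1) (mD2 : measurable D2).
Local Open Scope ereal_scope.

Lemma measurable_fun_sectionl d3 (T3 : measurableType d3) (F : T1 * T2 -> T3) x :
  measurable_fun (D1 `*` D2) F -> D1 x -> measurable_fun D2 (fun y => F (x, y)).
Proof.
move=> mF D1x; apply: (measurable_comp (F := D1 `*` D2)) mF _.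
- exact: measurableX.
- by move=> _ [y D2y <-].
- by apply: measurable_funTS; exact: measurable_pair1.
Qed.

Lemma measurable_fun_sectionr d3 (T3 : measurableType d3) (F : T1 * T2 -> T3) y :
  measurable_fun (D1 `*` D2) F -> D2 y -> measurable_fun D1 (fun x => F (x, y)).
Proof.
move=> mF D2y; apply: (measurable_comp (F := D1 `*` D2)) mF _.
- exact: measurableX.
- by move=> _ [x D1x <-].
- by apply: measurable_funTS; exact: measurable_pair2.
Qed.

Lemma measurable_fun_comp_fst d3 (T3 : measurableType d3) (f : T1 -> T3) :
  measurable_fun D1 f -> measurable_fun (D1 `*` D2) (fun z => f z.1).
Proof.
move=> mf; apply: (measurable_comp (F := D1)) mf _ => //.
- by move=> _ [[x y] [/= D1x _] <-].
- by apply: measurable_funTS; exact: measurable_fst.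
Qed.

Lemma measurable_fun_comp_snd d3 (T3 : measurableType d3) (f : T2 -> T3) :
  measurable_fun D2 f -> measurable_fun (D1 `*` D2) (fun z => f z.2).
Proof.
move=> mf; apply: (measurable_comp (F := D2)) mf _ => //.
- by move=> _ [[x y] [/= _ D2y] <-].
- by apply: measurable_funTS; exact: measurable_snd.
Qed.

Let restrictX (F : T1 * T2 -> \bar R) x y : (F \_ (D1 `*` D2)) (x, y) =
  (fun x => ((fun y => F (x, y)) \_ D2) y) \_ D1 x.
Proof.
rewrite /patch in_setX; case: (x \in D1); case: (y \in D2) => //.
Qed.

Lemma ge0_measurable_fun_integrall (F : T1 * T2 -> \bar R) :
  measurable_fun (D1 `*` D2) F ->
  (forall x y, D1 x -> D2 y -> 0 <= F (x, y)) ->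
  measurable_fun D1 (fun x => \int[m2]_(y in D2) F (x, y)).
Proof.
move=> mF F0; have mX : measurable (D1 `*` D2) by exact: measurableX.
have F0' z : 0 <= (F \_ (D1 `*` D2)) z.
  rewrite /patch; case: ifPn => // /set_mem; case: z => x y [/= ? ?].
  exact: F0.
have := measurable_fun_fubini_tonelli_F (m2 := m2) _ ((measurable_restrictT _ mX).1 mF) F0'.
move=> /(measurable_funS measurableT (@subsetT _ D1)).
apply: eq_measurable_fun => x /set_mem D1x.
rewrite /fubini_F [RHS]integral_mkcond; apply: eq_integral => y _.
by rewrite restrictX /patch mem_set.
Qed.

Lemma ge0_measurable_fun_integralr (F : T1 * T2 -> \bar R) :
  measurable_fun (D1 `*` D2) F ->
  (forall x y, D1 x -> D2 y -> 0 <= F (x, y)) ->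
  measurable_fun D2 (fun y => \int[m1]_(x in D1) F (x, y)).
Proof.
move=> mF F0; have mX : measurable (D1 `*` D2) by exact: measurableX.
have F0' z : 0 <= (F \_ (D1 `*` D2)) z.
  rewrite /patch; case: ifPn => // /set_mem; case: z => x y [/= ? ?].
  exact: F0.
have := measurable_fun_fubini_tonelli_G (m1 := m1) _ ((measurable_restrictT _ mX).1 mF) F0'.
move=> /(measurable_funS measurableT (@subsetT _ D2)).
apply: eq_measurable_fun => y /set_mem D2y.
rewrite /fubini_G [RHS]integral_mkcond; apply: eq_integral => x _.
by rewrite restrictX /patch (mem_set D2y).
Qed.

Lemma tonelli_on (F : T1 * T2 -> \bar R) :
  measurable_fun (D1 `*` D2) F ->
  (forall x y, D1 x -> D2 y -> 0 <= F (x, y)) ->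
  \int[m1]_(x in D1) \int[m2]_(y in D2) F (x, y) =
  \int[m2]_(y in D2) \int[m1]_(x in D1) F (x, y).
Proof.
move=> mF F0; have mX : measurable (D1 `*` D2) by exact: measurableX.
have F0' z : 0 <= (F \_ (D1 `*` D2)) z.
  rewrite /patch; case: ifPn => // /set_mem; case: z => x y [/= ? ?].
  exact: F0.
have := fubini_tonelli (m1 := m1) (m2 := m2) _ ((measurable_restrictT _ mX).1 mF) F0'.
congr (_ = _).
- rewrite [RHS]integral_mkcond; apply: eq_integral => x _.
  rewrite [RHS]/patch; case: ifPn => D1x.
    rewrite [RHS]integral_mkcond; apply: eq_integral => y _.
    by rewrite restrictX /patch D1x.
  apply: integral0_eq => y _; rewrite restrictX /patch.
  by rewrite (negbTE D1x).
- rewrite [RHS]integral_mkcond; apply: eq_integral => y _.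
  rewrite [RHS]/patch; case: ifPn => D2y.
    rewrite [RHS]integral_mkcond; apply: eq_integral => x _.
    by rewrite restrictX /patch D2y.
  apply: integral0_eq => x _; rewrite restrictX /patch.
  by rewrite (negbTE D2y); case: ifP.
Qed.

(** Cauchy-Schwarz applied to k h <= sqrt p * (sqrt q * h) bounds the square of the
    inner integral by A * \int q(x, y) h(y)^2 dy; integrating in x and exchanging
    the integrals lets the second bound act on q alone. *)
Lemma schur_test (p q k : T1 -> T2 -> R) (A B : R) (h : T2 -> R) :
  (0 <= A)%R -> (0 <= B)%R ->
  measurable_fun (D1 `*` D2) (fun z => p z.1 z.2) ->
  measurable_fun (D1 `*` D2) (fun z => q z.1 z.2) ->
  measurable_fun (D1 `*` D2) (fun z => k z.1 z.2) ->
  measurable_fun D2 h ->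
  (forall x y, D1 x -> D2 y -> 0 <= p x y)%R ->
  (forall x y, D1 x -> D2 y -> 0 <= q x y)%R ->
  (forall x y, D1 x -> D2 y -> 0 <= k x y)%R ->
  (forall y, D2 y -> 0 <= h y)%R ->
  (forall x y, D1 x -> D2 y -> k x y ^+ 2 <= p x y * q x y)%R ->
  (forall x, D1 x -> \int[m2]_(y in D2) (p x y)%:E <= A%:E) ->
  (forall y, D2 y -> \int[m1]_(x in D1) (q x y)%:E <= B%:E) ->
  \int[m1]_(x in D1) (\int[m2]_(y in D2) (k x y * h y)%:E) ^+ 2 <=
  (A * B)%:E * \int[m2]_(y in D2) (h y ^+ 2)%:E.
Proof.
move=> A0 B0 mp mq mk mh p0 q0 k0 h0 kpq pA qB.
have mqh : measurable_fun (D1 `*` D2) (fun z => q z.1 z.2 * h z.2 ^+ 2)%R.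
  apply: measurable_funM => //; apply: measurable_funX.
  exact: measurable_fun_comp_snd.
have mkh : measurable_fun (D1 `*` D2) (fun z => k z.1 z.2 * h z.2)%R.
  by apply: measurable_funM => //; exact: measurable_fun_comp_snd.
have mkhx : measurable_fun D1 (fun x => \int[m2]_(y in D2) (k x y * h y)%:E).
  apply: (ge0_measurable_fun_integrall (F := fun z => (k z.1 z.2 * h z.2)%:E)).
    exact/measurable_EFinP.
  by move=> x y D1x D2y /=; rewrite lee_fin mulr_ge0 ?k0 ?h0.
have mqhx : measurable_fun D1 (fun x => \int[m2]_(y in D2) (q x y * h y ^+ 2)%:E).
  apply: (ge0_measurable_fun_integrall (F := fun z => (q z.1 z.2 * h z.2 ^+ 2)%:E)).
    exact/measurable_EFinP.
  by move=> x y D1x D2y /=; rewrite lee_fin mulr_ge0 ?q0 ?sqr_ge0.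
have qh0 x y : D1 x -> D2 y -> 0 <= (q x y * h y ^+ 2)%:E.
  by move=> D1x D2y; rewrite lee_fin mulr_ge0 ?q0 ?sqr_ge0.
apply: (@le_trans _ _ (\int[m1]_(x in D1)
    (A%:E * \int[m2]_(y in D2) (q x y * h y ^+ 2)%:E))).
  apply: ge0_le_integral => //.
  - by move=> x _; exact: sqre_ge0.
  - by rewrite [X in measurable_fun _ X](_ : _ = (fun x => \int[m2]_(y in D2) (k x y * h y)%:E)
      \* (fun x => \int[m2]_(y in D2) (k x y * h y)%:E)); [exact: emeasurable_funM|].
  - exact: measurable_funeM.
  move=> x D1x.
  have mpx := measurable_fun_sectionl mp D1x.
  have mqx := measurable_fun_sectionl mq D1x.
  have mkx := measurable_fun_sectionl mk D1x.
  have msqrt (f : T2 -> R) : measurable_fun D2 f -> measurable_fun D2 (fun y => Num.sqrt (f y)).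
    move=> mf; have msq : measurable_fun [set: R] (@Num.sqrt R).
      exact: continuous_measurable_fun (@sqrt_continuous R).
    exact: (measurableT_comp msq mf).
  have := @cauchy_schwarz_integral _ T2 R m2 D2 (fun y => Num.sqrt (p x y))
    (fun y => Num.sqrt (q x y) * h y)%R mD2 (msqrt _ mpx)
    (measurable_funM (msqrt _ mqx) mh).
  move=> cs; apply: le_trans (le_trans cs _).
    rewrite !expe2; suff le : \int[m2]_(y in D2) (k x y * h y)%:E <=
        \int[m2]_(y in D2) (`|Num.sqrt (p x y) * (Num.sqrt (q x y) * h y)|)%:E.
      by apply: lee_pmul => //; apply: integral_ge0 => y D2y; rewrite lee_fin mulr_ge0 ?k0 ?h0.
    apply: ge0_le_integral => //.
    + by move=> y D2y; rewrite lee_fin mulr_ge0 ?k0 ?h0.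
    + by apply/measurable_EFinP; exact: measurable_funM.
    + apply/measurable_EFinP; apply: measurableT_comp => //.
      by apply: measurable_funM; [exact: msqrt|apply: measurable_funM => //; exact: msqrt].
    + move=> y D2y; rewrite lee_fin mulrA -sqrtrM ?p0// normrM (ger0_norm (h0 _ D2y)).
      rewrite ger0_norm ?sqrtr_ge0// ler_wpM2r ?h0// -[leLHS]ger0_norm ?k0// -sqrtr_sqr.
      exact/ler_wsqrtr/kpq.
  apply: lee_pmul.
  - by apply: integral_ge0 => y _; rewrite lee_fin sqr_ge0.
  - by apply: integral_ge0 => y _; rewrite lee_fin sqr_ge0.
  - rewrite (eq_integral (fun y => (p x y)%:E)) ?pA// => y /set_mem D2y.
    by rewrite sqr_sqrtr ?p0.
  - rewrite (eq_integral (fun y => (q x y * h y ^+ 2)%:E))// => y /set_mem D2y.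
    by rewrite exprMn sqr_sqrtr ?q0.
rewrite ge0_integralZl_EFin//; last first.
  by move=> x D1x; apply: integral_ge0 => y D2y; exact: qh0.
rewrite EFinM -muleA; apply: lee_wpmul2l; first by rewrite lee_fin.
rewrite (tonelli_on (F := fun z => (q z.1 z.2 * h z.2 ^+ 2)%:E)) /=; last 2 first.
- exact/measurable_EFinP.
- by move=> x y; exact: qh0.
rewrite -ge0_integralZl_EFin//; last 2 first.
- by move=> y _; rewrite lee_fin sqr_ge0.
- by apply/measurable_EFinP; exact: measurable_funX.
apply: ge0_le_integral => //.
- by move=> y D2y; apply: integral_ge0 => x D1x; exact: qh0.
- apply: (ge0_measurable_fun_integralr (F := fun z => (q z.1 z.2 * h z.2 ^+ 2)%:E)).
    exact/measurable_EFinP.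
  by move=> x y; exact: qh0.
- by apply: measurable_funeM; apply/measurable_EFinP; exact: measurable_funX.
move=> y D2y.
under eq_integral do rewrite EFinM.
rewrite ge0_integralZr//.
- by apply: lee_wpmul2r; [rewrite lee_fin sqr_ge0|exact: qB].
- by apply/measurable_EFinP; exact: measurable_fun_sectionr mq D2y.
- by move=> x D1x; rewrite lee_fin q0.
- by rewrite lee_fin sqr_ge0.
Qed.
End product_domain.

(** * The weight x^(1/2) against tails *)

Definition tail_bounded (R : realType) (u : R -> R) (A : R) : Prop :=
  forall y, 0 < y ->
    (y%:E * \int[lebesgue_measure]_(t in `[y, +oo[) (u t ^+ 2)%:E <= A%:E)%E.

Section weights.
Local Open Scope ereal_scope.
Variable R : realType.
Notation mu := (@lebesgue_measure R).

Lemma measurable_Rpos : default_measure_display.-measurable (@Rpos R).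
Proof.
rewrite (_ : Rpos = `]0%R, +oo[%classic); first exact: measurable_itv.
by apply/seteqP; split => x; rewrite /Rpos/= in_itv/= andbT.
Qed.
Local Hint Extern 0 (measurable Rpos) => solve [exact: measurable_Rpos] : core.

Lemma measurable_fun_sqrt_inv : measurable_fun Rpos (fun x : R => (Num.sqrt x)^-1)%R.
Proof.
have : measurable_fun Rpos (fun x : R => (Num.sqrt x) `^ (-1))%R.
  apply: (measurableT_comp (measurable_powR (R := R) (-1))).
  by apply: measurable_funTS; exact: continuous_measurable_fun (@sqrt_continuous R).
by apply: eq_measurable_fun => x _ /=; rewrite powR_inv1// sqrtr_ge0.
Qed.

Lemma measurable_fun_sqrt (D : set R) : measurable_fun D (@Num.sqrt R).
Proof.
apply: measurable_funTS; exact: continuous_measurable_fun (@sqrt_continuous R).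
Qed.

Lemma sqrt_expr4 k : Num.sqrt (4 ^+ k : R) = (2 ^+ k)%R.
Proof.
by rewrite -[RHS]ger0_norm ?exprn_ge0// -sqrtr_sqr -exprM mulnC exprM expr2 -natrM.
Qed.

(** Locates a point in the shell decomposition by powers of b. *)
Lemma exists_expn_shell (b : nat) (z : R) : (1 < b)%N -> (1 <= z)%R ->
  exists k, (b%:R ^+ k <= z < b%:R ^+ k.+1)%R.
Proof.
move=> b1 z1.
have [n zn] : exists n, (z < b%:R ^+ n)%R.
  exists (Num.bound z); apply: lt_le_trans (upper_nthrootP (leqnn _)) _.
  by apply: lerXn2r; rewrite ?nnegrE ?ler0n// ler_nat.
have [m zm minm] := ex_minnP (ex_intro (fun n => (z < b%:R ^+ n)%R) n zn).
case: m zm minm => [|m] zm minm; first by move: zm; rewrite expr0 ltNge z1.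
exists m; rewrite zm andbT leNgt; apply/negP => /minm; by rewrite ltnn.
Qed.

(** The exact value is 2 x^(1/2); the shells of ratio 4 give a slightly larger
    constant without an antiderivative that is singular at 0.  With ratio 4 the
    square roots of the shell ends are x^(1/2) / 2^k. *)
Lemma integral_inv_sqrt_le (x : R) : (0 < x)%R ->
  \int[mu]_(y in `]0%R, x]) ((Num.sqrt y)^-1)%:E <= (4 * Num.sqrt x)%:E.
Proof.
move=> x0; pose F k : set R := `](x / 4 ^+ k.+1)%R, (x / 4 ^+ k)%R]%classic.
have e0 k : (0 < (4:R) ^+ k)%R by rewrite exprn_gt0.
have e20 k : (0 < (2:R) ^+ k)%R by rewrite exprn_gt0.
have FR : \bigcup_k F k `<=` Rpos.
  move=> y [k _]; rewrite /F/= in_itv/= => /andP[+ _]; apply: lt_trans.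
  by rewrite divr_gt0.
have cover : `]0%R, x]%classic `<=` \bigcup_k F k.
  move=> y/=; rewrite in_itv/= => /andP[y0 yx].
  have xy1 : (1 <= x / y)%R by rewrite ler_pdivlMr// mul1r.
  have [k /andP[k1 k2]] := exists_expn_shell (isT : (1 < 4)%N) xy1.
  exists k => //; rewrite /F/= in_itv/=.
  rewrite ltr_pdivrMr// mulrC -ltr_pdivrMr// k2/=.
  by rewrite ler_pdivlMr// mulrC -ler_pdivlMr.
have mFk k : measurable (F k) by exact: measurable_itv.
have mF : measurable (\bigcup_k F k) by exact: bigcup_measurable.
have mf : measurable_fun (\bigcup_k F k) (fun y : R => ((Num.sqrt y)^-1)%:E).
  apply/measurable_EFinP; apply: measurable_funS FR _ => //.
  exact: measurable_fun_sqrt_inv.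
have f0 (y : R) : 0 <= ((Num.sqrt y)^-1)%:E by rewrite lee_fin invr_ge0 sqrtr_ge0.
apply: (@le_trans _ _ (\int[mu]_(y in \bigcup_k F k) ((Num.sqrt y)^-1)%:E)).
  by apply: ge0_subset_integral => //; exact: measurable_itv.
have -> : (4 * Num.sqrt x = 2 * (2 * Num.sqrt x))%R by ring.
apply: ge0_integral_bigcup_geometric => // k.
apply: (@le_trans _ _ (\int[mu]_(y in F k) (2 ^+ k.+1 / Num.sqrt x)%:E)).
  apply: ge0_le_integral => //; first exact: mFk.
  - apply: measurable_funS mf => //; exact: bigcup_sup.
  - move=> y; rewrite /F/= in_itv/= lee_fin => /andP[ky _].
    rewrite -[leRHS]invrK invf_div lef_pV2 ?posrE ?sqrtr_gt0//.
    + have -> : (Num.sqrt x / 2 ^+ k.+1 = Num.sqrt (x / 4 ^+ k.+1))%R.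
        by rewrite sqrtrM ?ltW// sqrtrV ?sqrt_expr4// ltW.
      exact/ler_wsqrtr/ltW.
    + by apply: lt_trans ky; rewrite divr_gt0.
    + by rewrite divr_gt0// sqrtr_gt0.
rewrite integral_cst; last exact: mFk.
rewrite /F /= lebesgue_measure_itv/= lte_fin ltr_pM2l// ltf_pV2 ?posrE//.
rewrite ltr_eXn2l ?ltr1n// ltnSn -EFinD -EFinM lee_fin.
have alg (s a : R) : (0 < s -> 0 < a ->
    a * 2 / s * (s * s / (a * a) - s * s / (a * a * 4)) <= 2 * s / a)%R.
  move=> s0 a0; have [s1 a1] : s != 0%R /\ a != 0%R by rewrite !gt_eqF.
  rewrite (_ : _ * _ = 3 / 2 * (s / a))%R; last by field; rewrite s1 a1.
  rewrite -[leRHS]mulrA ler_wpM2r ?divr_ge0 ?ltW//; lra.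
have sx0 : (0 < Num.sqrt x)%R by rewrite sqrtr_gt0.
have := alg _ _ sx0 (e20 k).
by rewrite -(expr2 (Num.sqrt x)) sqr_sqrtr ?(ltW x0)// -exprMn -natrM -!exprSr.
Qed.

Section tail.
Variables (u : R -> R) (A : R).
Hypothesis mfu : measurable_fun Rpos u.
Hypothesis uA : tail_bounded u A.

Lemma tail_bound_ge0 : (0 <= A)%R.
Proof.
rewrite -lee_fin; apply: le_trans (uA ltr01); rewrite mul1e.
by apply: integral_ge0 => t _; rewrite lee_fin sqr_ge0.
Qed.

(** On the shell [y 4^k, y 4^(k+1)[ the weight is at most y^(1/2) 2^(k+1) while the
    mass of u^2 is at most A / (y 4^k), so the contributions decay like 2^-k. *)
Lemma integral_tail_sqrt_le (y : R) : (0 < y)%R ->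
  \int[mu]_(t in `[y, +oo[) (u t ^+ 2 * Num.sqrt t)%:E <=
  (4 * A / Num.sqrt y)%:E.
Proof.
move=> y0; pose F k : set R := `[(y * 4 ^+ k)%R, (y * 4 ^+ k.+1)%R[%classic.
have e0 k : (0 < (4:R) ^+ k)%R by rewrite exprn_gt0.
have e20 k : (0 < (2:R) ^+ k)%R by rewrite exprn_gt0.
have FR : \bigcup_k F k `<=` Rpos.
  move=> t [k _]; rewrite /F/= in_itv/= => /andP[+ _]; apply: lt_le_trans.
  by rewrite mulr_gt0.
have cover : `[y, +oo[%classic `<=` \bigcup_k F k.
  move=> t/=; rewrite in_itv/= andbT => yt.
  have ty1 : (1 <= t / y)%R by rewrite ler_pdivlMr// mul1r.
  have [k /andP[k1 k2]] := exists_expn_shell (isT : (1 < 4)%N) ty1.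
  exists k => //; rewrite /F/= in_itv/=.
  by rewrite mulrC -ler_pdivlMr// k1/= mulrC -ltr_pdivrMr.
have mFk k : measurable (F k) by exact: measurable_itv.
have mF : measurable (\bigcup_k F k) by exact: bigcup_measurable.
have mf : measurable_fun Rpos (fun t : R => (u t ^+ 2 * Num.sqrt t)%:E).
  apply/measurable_EFinP; apply: measurable_funM; first exact: measurable_funX.
  exact: measurable_fun_sqrt.
have mfF : measurable_fun (\bigcup_k F k) (fun t : R => (u t ^+ 2 * Num.sqrt t)%:E).
  exact: measurable_funS FR mf.
have mu2 D : measurable D -> D `<=` Rpos -> measurable_fun D (fun t : R => (u t ^+ 2)%:E).
  move=> mD DR; apply/measurable_EFinP; apply: measurable_funX.
  exact: measurable_funS DR mfu.
have f0 (t : R) : 0 <= (u t ^+ 2 * Num.sqrt t)%:E by rewrite lee_fin mulr_ge0 ?sqr_ge0 ?sqrtr_ge0.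
apply: (@le_trans _ _ (\int[mu]_(t in \bigcup_k F k) (u t ^+ 2 * Num.sqrt t)%:E)).
  by apply: ge0_subset_integral => //; exact: measurable_itv.
have -> : (4 * A / Num.sqrt y = 2 * (2 * A / Num.sqrt y))%R by ring.
apply: ge0_integral_bigcup_geometric => // k.
have FkR : F k `<=` Rpos by move=> t Ft; apply: FR; exists k.
have tailR : `[(y * 4 ^+ k)%R, +oo[%classic `<=` Rpos.
  move=> t/=; rewrite in_itv/= andbT; apply: lt_le_trans; exact: mulr_gt0.
apply: (@le_trans _ _ (\int[mu]_(t in F k)
   ((Num.sqrt y * 2 ^+ k.+1)%:E * (u t ^+ 2)%:E))).
  apply: ge0_le_integral => //; first exact: mFk.
  - exact: measurable_funS FkR mf.
  - by apply: measurable_funeM; exact: mu2.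
  - move=> t; rewrite /F/= in_itv/= => /andP[_ tk].
    rewrite -EFinM lee_fin mulrC ler_wpM2r ?sqr_ge0// -sqrt_expr4 -sqrtrM ?(ltW y0)//.
    exact/ler_wsqrtr/ltW.
rewrite ge0_integralZl_EFin; last 4 first.
- exact: mFk.
- by move=> t _; rewrite lee_fin sqr_ge0.
- by apply: mu2 => //; exact: mFk.
- by rewrite mulr_ge0 ?sqrtr_ge0// ltW.
apply: (@le_trans _ _ ((Num.sqrt y * 2 ^+ k.+1)%:E *
   ((y * 4 ^+ k)^-1 * A)%:E)).
  apply: lee_wpmul2l; first by rewrite lee_fin mulr_ge0 ?sqrtr_ge0// ltW.
  rewrite EFinM -lee_pdivrMl ?invr_gt0 ?mulr_gt0// invrK.
  apply: le_trans (uA (mulr_gt0 y0 (e0 k))).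
  apply: lee_wpmul2l; first by rewrite lee_fin ltW// mulr_gt0.
  apply: ge0_subset_integral.
  - exact: mFk.
  - exact: measurable_itv.
  - by apply: mu2 => //; exact: measurable_itv.
  - by move=> t _; rewrite lee_fin sqr_ge0.
  - by move=> t; rewrite /F/= !in_itv/= andbT => /andP[].
rewrite -EFinM lee_fin.
have alg (s a : R) : (0 < s -> 0 < a ->
    s * (a * 2) * ((s * s * (a * a))^-1 * A) = 2 * A / s / a)%R.
  move=> s0 a0; have [s1 a1] : s != 0%R /\ a != 0%R by rewrite !gt_eqF.
  by field; rewrite s1 a1.
have sy0 : (0 < Num.sqrt y)%R by rewrite sqrtr_gt0.
have := alg _ _ sy0 (e20 k).
by rewrite -(expr2 (Num.sqrt y)) sqr_sqrtr ?(ltW y0)// -exprMn -natrM -!exprSr => ->.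
Qed.
End tail.
End weights.
Arguments measurable_Rpos {R}.
Arguments measurable_fun_sqrt_inv {R}.

(** * The positive kernel u(max(x, y)) *)

Section max_kernel.
Variables (R : realType) (u : R -> R) (A : R).
Notation mu := (@lebesgue_measure R).
Hypothesis u0 : forall x, 0 <= u x.
Hypothesis mfu : measurable_fun Rpos u.
Hypothesis uA : tail_bounded u A.
Local Hint Extern 0 (measurable Rpos) => solve [exact: measurable_Rpos] : core.

(** Both terms are present on the diagonal: there the product of the weight with
    its transpose must still dominate u(x)^2, and the sum achieves it by the
    inequality between arithmetic and geometric means. *)
Definition schur_weight (x y : R) : R :=
  (if y <= x then (Num.sqrt x * Num.sqrt y)^-1 else 0) +
  (if x <= y then u y ^+ 2 * (Num.sqrt x * Num.sqrt y) else 0).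

Lemma schur_weight_ge0 x y : 0 <= schur_weight x y.
Proof.
have s0 : 0 <= Num.sqrt x * Num.sqrt y by rewrite mulr_ge0 ?sqrtr_ge0.
rewrite addr_ge0//.
  by case: ifP => // _; rewrite invr_ge0.
by case: ifP => // _; rewrite mulr_ge0 ?sqr_ge0.
Qed.

Lemma sqr_max_kernel_le x y : 0 < x -> 0 < y ->
  u (Num.max x y) ^+ 2 <= schur_weight x y * schur_weight y x.
Proof.
move=> x0 y0; rewrite /schur_weight [Num.sqrt y * _]mulrC.
set s := Num.sqrt x * Num.sqrt y.
have s0 : 0 < s by rewrite mulr_gt0 ?sqrtr_gt0.
have s1 : s != 0 by rewrite gt_eqF.
case: (ltgtP x y) => xy.
- by rewrite add0r addr0 mulfK.
- by rewrite add0r addr0 mulrC mulfK.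
- rewrite -xy -(@ler_pM2l _ (s ^+ 2)) ?exprn_gt0//.
  set a := u x ^+ 2.
  have a0 : 0 <= a by exact: sqr_ge0.
  (* After multiplication by s^2 the claim is a s^2 <= (1 + a s^2)^2. *)
  rewrite [leRHS](_ : _ = (1 + a * s ^+ 2) ^+ 2); last by field; exact: s1.
  have : 0 <= s ^+ 2 * a by rewrite mulr_ge0 ?sqr_ge0.
  have : 0 <= (s ^+ 2 * a) ^+ 2 by rewrite sqr_ge0.
  rewrite mulrC; nra.
Qed.

Let mX : measurable (@Rpos R `*` @Rpos R).
Proof. exact: measurableX. Qed.

Lemma measurable_fun_max_kernel (f : R -> R) : measurable_fun Rpos f ->
  measurable_fun (@Rpos R `*` @Rpos R) (fun z => f (Num.max z.1 z.2)).
Proof.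
move=> mf; apply: (measurable_comp (F := @Rpos R)) mf _.
  exact: measurable_Rpos.
  by move=> _ [[x y] [/= x0 y0] <-]; rewrite /Rpos/= lt_max x0.
by apply: measurable_maxr; apply: measurable_funTS;
  [exact: measurable_fst|exact: measurable_snd].
Qed.

Lemma measurable_fun_schur_weight :
  measurable_fun (@Rpos R `*` @Rpos R) (fun z => schur_weight z.1 z.2).
Proof.
have ms : measurable_fun (@Rpos R) (@Num.sqrt R) by exact: measurable_fun_sqrt.
have m1 : measurable_fun (@Rpos R `*` @Rpos R) (fun z => z.1).
  by apply: measurable_funTS; exact: measurable_fst.
have m2 : measurable_fun (@Rpos R `*` @Rpos R) (fun z => z.2).
  by apply: measurable_funTS; exact: measurable_snd.
apply: measurable_funD; apply: measurable_fun_if => //.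
- exact: measurable_fun_ler.
- apply: (@measurable_funS _ _ _ _ (@Rpos R `*` @Rpos R)) => //.
  rewrite (_ : (fun _ => _) = fun z => (Num.sqrt z.1)^-1 * (Num.sqrt z.2)^-1).
    apply: measurable_funM.
      exact: (measurable_fun_comp_fst measurable_Rpos measurable_fun_sqrt_inv).
    exact: (measurable_fun_comp_snd measurable_Rpos measurable_fun_sqrt_inv).
  by apply/funext => z; rewrite invfM.
- exact: measurable_fun_ler.
- apply: (@measurable_funS _ _ _ _ (@Rpos R `*` @Rpos R)) => //.
  apply: measurable_funM; first by apply: measurable_funX; exact: (measurable_fun_comp_snd measurable_Rpos mfu).
  apply: measurable_funM.
    exact: (measurable_fun_comp_fst measurable_Rpos ms).
  exact: (measurable_fun_comp_snd measurable_Rpos ms).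
Qed.

Lemma measurable_fun_schur_weight_swap :
  measurable_fun (@Rpos R `*` @Rpos R) (fun z => schur_weight z.2 z.1).
Proof.
have sub : (fun z : R * R => (z.2, z.1)) @` (@Rpos R `*` @Rpos R) `<=` @Rpos R `*` @Rpos R.
  by move=> _ [[x y] [/= ? ?] <-].
have msw : measurable_fun (@Rpos R `*` @Rpos R) (fun z : R * R => (z.2, z.1)).
  by apply: measurable_funTS; exact: measurable_fun_pair.
exact: (measurable_comp mX sub measurable_fun_schur_weight msw).
Qed.

(** The two bounds that the Schur test asks for coincide, since the second weight
    is the transpose of the first. *)
Lemma integral_schur_weight_le x : 0 < x ->
  (\int[mu]_(y in Rpos) (schur_weight x y)%:E <= (4 + 4 * A)%:E)%E.
Proof.
move=> x0; have sx0 : 0 < Num.sqrt x by rewrite sqrtr_gt0.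
have ms (D : set R) : measurable_fun D (@Num.sqrt R) by exact: measurable_fun_sqrt.
have mw2 : measurable_fun Rpos (fun y => u y ^+ 2 * (Num.sqrt x * Num.sqrt y)).
  apply: measurable_funM; first exact: measurable_funX.
  by apply: measurable_funM.
have mw1 : measurable_fun Rpos (fun y => (Num.sqrt x * Num.sqrt y)^-1).
  rewrite (_ : (fun _ => _) = fun y => (Num.sqrt x)^-1 * (Num.sqrt y)^-1).
    by apply: measurable_funM => //; exact: measurable_fun_sqrt_inv.
  by apply/funext => z; rewrite invfM.
have w10 y : 0 <= (Num.sqrt x * Num.sqrt y)^-1.
  by rewrite invr_ge0 mulr_ge0 ?sqrtr_ge0.
have w20 y : 0 <= u y ^+ 2 * (Num.sqrt x * Num.sqrt y).
  by rewrite mulr_ge0 ?sqr_ge0// mulr_ge0 ?sqrtr_ge0.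
have le_meas (D : set R) : measurable_fun D (fun y => x <= y) /\
    measurable_fun D (fun y => y <= x).
  by split; apply: measurable_fun_ler.
under eq_integral do rewrite EFinD.
rewrite ge0_integralD//; last 4 first.
- by move=> y _; case: ifP => // _; rewrite lee_fin.
- apply/measurable_EFinP; apply: measurable_fun_if => //; first by case: (le_meas Rpos).
  by apply: (@measurable_funS _ _ _ _ (@Rpos R)).
- by move=> y _; case: ifP => // _; rewrite lee_fin.
- apply/measurable_EFinP; apply: measurable_fun_if => //; first by case: (le_meas Rpos).
  by apply: (@measurable_funS _ _ _ _ (@Rpos R)).
rewrite EFinD; apply: leeD.
- have -> : (\int[mu]_(y in Rpos) (if y <= x then (Num.sqrt x * Num.sqrt y)^-1 else 0)%:E =
      \int[mu]_(y in `]0%R, x]) ((Num.sqrt x)^-1 * (Num.sqrt y)^-1)%:E)%E.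
    have -> : `]0, x]%classic = Rpos `&` `]-oo, x]%classic :> set R.
      apply/seteqP; split => y /=; rewrite /Rpos/= !in_itv/=.
        by move=> /andP.
      by move=> [-> ->].
    rewrite [RHS]integral_mkcondr; apply: eq_integral => y _.
    by rewrite /patch mem_setE in_itv/=; case: ifP => // _; rewrite invfM.
  under eq_integral do rewrite EFinM.
  rewrite ge0_integralZl_EFin; last 4 first.
  + exact: measurable_itv.
  + by move=> y _; rewrite lee_fin invr_ge0 sqrtr_ge0.
  + apply/measurable_EFinP; apply: measurable_funS measurable_fun_sqrt_inv => //.
    by move=> y/=; rewrite in_itv/= => /andP[].
  + by rewrite invr_ge0 sqrtr_ge0.
  by rewrite -lee_pdivlMl ?invr_gt0// invrK -EFinM mulrC integral_inv_sqrt_le.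
- have sub : `[x, +oo[%classic `<=` Rpos.
    by move=> y/=; rewrite in_itv/= andbT; exact: lt_le_trans.
  have -> : (\int[mu]_(y in Rpos) (if (x <= y)%R then u y ^+ 2 * (Num.sqrt x * Num.sqrt y) else 0)%:E =
      \int[mu]_(y in `[x, +oo[) (Num.sqrt x * (u y ^+ 2 * Num.sqrt y))%:E)%E.
    rewrite -(setIidr sub).
    rewrite [RHS]integral_mkcondr; apply: eq_integral => y _.
    by rewrite /patch mem_setE in_itv/= andbT; case: ifP => // _; rewrite mulrCA.
  under eq_integral do rewrite EFinM.
  rewrite ge0_integralZl_EFin; last 4 first.
  + exact: measurable_itv.
  + by move=> y _; rewrite lee_fin mulr_ge0 ?sqr_ge0 ?sqrtr_ge0.
  + apply/measurable_EFinP; apply: measurable_funM => //.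
    by apply: measurable_funX; exact: measurable_funS mfu.
    exact: ms.
  + exact: sqrtr_ge0.
  by rewrite -lee_pdivlMl// -EFinM mulrC integral_tail_sqrt_le.
Qed.

Lemma max_kernel_bound (h : R -> R) : measurable_fun Rpos h -> (forall y, 0 <= h y) ->
  (\int[mu]_(x in Rpos) (\int[mu]_(y in Rpos) (u (Num.max x y) * h y)%:E) ^+ 2 <=
   ((4 + 4 * A) ^+ 2)%:E * \int[mu]_(y in Rpos) (h y ^+ 2)%:E)%E.
Proof.
move=> mh h0.
have A0 : 0 <= 4 + 4 * A by rewrite addr_ge0// mulr_ge0// (tail_bound_ge0 uA).
rewrite expr2.
apply: (@schur_test _ _ _ _ R mu mu Rpos Rpos _ _ schur_weight
  (fun x y => schur_weight y x) (fun x y => u (Num.max x y))) => //.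
- exact: measurable_fun_schur_weight.
- exact: measurable_fun_schur_weight_swap.
- exact: measurable_fun_max_kernel.
- by move=> x y _ _; exact: schur_weight_ge0.
- by move=> x y _ _; exact: schur_weight_ge0.
- exact: sqr_max_kernel_le.
- exact: integral_schur_weight_le.
- exact: integral_schur_weight_le.
Qed.

(** The integrand is the constant u(x)^2 on ]0, x[ and u^2 beyond x; its finiteness
    makes the kernel integrals converge for every x, not merely almost every x. *)
Lemma integral_sqr_max_kernel_lty x : 0 < x ->
  (\int[mu]_(y in Rpos) (u (Num.max x y) ^+ 2)%:E < +oo)%E.
Proof.
move=> x0.
have mf : measurable_fun Rpos (fun y => (u (Num.max x y) ^+ 2)%:E).
  apply/measurable_EFinP; apply: measurable_funX.
  exact: measurable_fun_sectionl (measurable_fun_max_kernel mfu) x0.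
have RE : Rpos = `]0, x[ `|` `[x, +oo[ :> set R.
  apply/seteqP; split => y; rewrite /Rpos/= !in_itv/= andbT.
    by move=> ->/=; case: ltP; [left|right].
  by case=> [/andP[]//|]; exact: lt_le_trans.
rewrite RE in mf *.
rewrite ge0_integral_setU//; last 2 first.
- by move=> y _; rewrite lee_fin sqr_ge0.
- rewrite disj_set2E; apply/eqP/seteqP; split => y //=.
  by rewrite !in_itv/= => -[/andP[_ yx]]; rewrite andbT leNgt yx.
apply: lte_add_pinfty.
- rewrite (eq_integral (fun=> (u x ^+ 2)%:E)).
    rewrite integral_cst//= lebesgue_measure_itv/= lte_fin x0 -EFinD -EFinM.
    exact: ltry.
  by move=> y; rewrite inE/= in_itv/= => /andP[_ yx]; rewrite max_l// ltW.
- have -> : (\int[mu]_(y in `[x, +oo[) (u (Num.max x y) ^+ 2)%:E =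
      \int[mu]_(y in `[x, +oo[) (u y ^+ 2)%:E)%E.
    by apply: eq_integral => y; rewrite inE/= in_itv/= andbT => xy; rewrite max_r.
  have := uA x0; rewrite -lee_pdivlMl// => /le_lt_trans; apply.
  by rewrite -EFinM ltry.
Qed.
End max_kernel.

(** * Complex integrals and the L2 norm *)

(** Both signs of F have integrals that are measurable in x, and so has their
    difference in the extended reals, whether or not it is of the form oo - oo. *)
Lemma measurable_fun_Rintegral_section d1 d2 (T1 : measurableType d1)
    (T2 : measurableType d2) (R : realType)
    (m2 : {sigma_finite_measure set T2 -> \bar R}) (D1 : set T1) (D2 : set T2)
    (F : T1 * T2 -> R) : measurable D1 -> measurable D2 ->
  measurable_fun (D1 `*` D2) F ->
  measurable_fun D1 (fun x => \int[m2]_(y in D2) F (x, y)).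
Proof.
move=> mD1 mD2 mF.
have mF' : measurable_fun (D1 `*` D2) (EFin \o F) by exact/measurable_EFinP.
have mp := ge0_measurable_fun_integrall m2 mD1 mD2 (measurable_funepos mF')
  (fun x y _ _ => funepos_ge0 _ _).
have mn := ge0_measurable_fun_integrall m2 mD1 mD2 (measurable_funeneg mF')
  (fun x y _ _ => funeneg_ge0 _ _).
rewrite /Rintegral; apply: (measurableT_comp (f := fine)).
  exact: fine_measurable.
rewrite (_ : (fun x => _) =
  (fun x => \int[m2]_(y in D2) (EFin \o F)^\+ (x, y))%E \-
  (fun x => \int[m2]_(y in D2) (EFin \o F)^\- (x, y))%E)%E.
  exact: emeasurable_funB.
apply/funext => x; rewrite integralE; congr (_ - _)%E; apply: eq_integral => y _.
  by rewrite !funeposE.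
by rewrite !funenegE.
Qed.

Section complex_integral.
Variable R : realType.
Notation mu := (@lebesgue_measure R).
Implicit Types (z : R[i]) (f g : R -> R[i]) (D : set R).

Lemma sqr_normcE z : normc z ^+ 2 = complex.Re z ^+ 2 + complex.Im z ^+ 2.
Proof. by case: z => a b; rewrite /normc sqr_sqrtr// addr_ge0 ?sqr_ge0. Qed.

Lemma normc_ge0 z : 0 <= normc z.
Proof. by case: z => a b; rewrite /normc sqrtr_ge0. Qed.

Lemma normr_Re_le_normc z : `|complex.Re z| <= normc z.
Proof.
rewrite -(@ler_pXn2r _ 2)// ?nnegrE ?normc_ge0// sqr_normcE real_normK ?num_real//.
by rewrite lerDl sqr_ge0.
Qed.

Lemma normr_Im_le_normc z : `|complex.Im z| <= normc z.
Proof.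
rewrite -(@ler_pXn2r _ 2)// ?nnegrE ?normc_ge0// sqr_normcE real_normK ?num_real//.
by rewrite lerDr sqr_ge0.
Qed.

Lemma normc_le_Re_Im z : normc z <= `|complex.Re z| + `|complex.Im z|.
Proof.
rewrite -(@ler_pXn2r _ 2)// ?nnegrE ?normc_ge0// ?addr_ge0// sqr_normcE.
rewrite sqrrD !real_normK ?num_real// addrAC lerDl.
by rewrite mulrn_wge0// mulr_ge0.
Qed.

Lemma complex_ReM (z w : R[i]) : complex.Re (z * w) =
  complex.Re z * complex.Re w - complex.Im z * complex.Im w.
Proof. by case: z => a b; case: w. Qed.

Lemma complex_ImM (z w : R[i]) : complex.Im (z * w) =
  complex.Re z * complex.Im w + complex.Im z * complex.Re w.
Proof. by case: z => a b; case: w. Qed.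

Lemma measurable_fun_normc d (T : measurableType d) (D : set T) (f : T -> R[i]) :
  measurable_fun D (fun x => complex.Re (f x)) ->
  measurable_fun D (fun x => complex.Im (f x)) ->
  measurable_fun D (fun x => normc (f x)).
Proof.
move=> mr mi.
have msq : measurable_fun [set: R] (@Num.sqrt R).
  exact: continuous_measurable_fun (@sqrt_continuous R).
have -> : (fun x => normc (f x)) =
    (@Num.sqrt R) \o (fun x => complex.Re (f x) ^+ 2 + complex.Im (f x) ^+ 2).
  by apply/funext => x /=; rewrite -sqr_normcE sqrtr_sqr ger0_norm ?normc_ge0.
apply: measurableT_comp => //.
by apply: measurable_funD; exact: measurable_funX.
Qed.

Lemma cmeasurable_normc D f : cmeasurable D f ->
  measurable_fun D (fun x => normc (f x)).
Proof. by case; exact: measurable_fun_normc. Qed.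

Lemma cmeasurableM D f g : cmeasurable D f -> cmeasurable D g ->
  cmeasurable D (fun x => f x * g x).
Proof.
move=> [mf1 mf2] [mg1 mg2]; split.
  under eq_fun do rewrite complex_ReM.
  by apply: measurable_funB; exact: measurable_funM.
under eq_fun do rewrite complex_ImM.
by apply: measurable_funD; exact: measurable_funM.
Qed.

Lemma cmeasurable_cst D z : cmeasurable D (fun=> z).
Proof. by split; exact: measurable_cst. Qed.

Lemma cmeasurableS D E f : measurable E -> D `<=` E -> cmeasurable E f -> cmeasurable D f.
Proof. by move=> mE DE [mf1 mf2]; split; exact: measurable_funS DE _. Qed.

(** The factor 2 comes from treating real and imaginary parts separately.  When f
    is not integrable the right-hand side is infinite. *)
Lemma normc_cintegral_le D f : measurable D -> cmeasurable D f ->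
  ((normc (cintegral D f))%:E <= 2%:E * \int[mu]_(x in D) (normc (f x))%:E)%E.
Proof.
move=> mD mf; have [mr mi] := mf.
have part (p : R -> R) : measurable_fun D p -> (forall x, `|p x| <= normc (f x)) ->
    ((`|\int[mu]_(x in D) p x|)%:E <= \int[mu]_(x in D) (normc (f x))%:E)%E.
  move=> mp pf; apply: (@le_trans _ _ (`|\int[mu]_(x in D) (p x)%:E|)%E).
    rewrite /Rintegral; case: (\int[mu]_(x in D) (p x)%:E)%E => [r| |] //=.
    - by rewrite normr0 leey.
    - by rewrite normr0 leey.
  apply: (@le_trans _ _ (\int[mu]_(x in D) (`|p x|)%:E)%E).
    by apply: le_abse_integral => //; exact/measurable_EFinP.
  apply: ge0_le_integral => //.
  - by apply/measurable_EFinP; exact: measurableT_comp.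
  - by apply/measurable_EFinP; exact: cmeasurable_normc.
  - by move=> x _; rewrite lee_fin.
apply: (@le_trans _ _ ((`|\int[mu]_(x in D) complex.Re (f x)|)%:E +
    (`|\int[mu]_(x in D) complex.Im (f x)|)%:E)%E).
  by rewrite -EFinD lee_fin; exact: normc_le_Re_Im.
rewrite mule_natl mule2n; apply: leeD; apply: part => // x.
- exact: normr_Re_le_normc.
- exact: normr_Im_le_normc.
Qed.

Definition cintegrable D f : Prop :=
  cmeasurable D f /\ (\int[mu]_(x in D) (normc (f x))%:E < +oo)%E.

Lemma cintegrable_Re_Im D f : measurable D -> cintegrable D f ->
  mu.-integrable D (fun x => (complex.Re (f x))%:E) /\
  mu.-integrable D (fun x => (complex.Im (f x))%:E).
Proof.
move=> mD [mf fy]; have [mr mi] := mf.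
have mn := cmeasurable_normc mf.
split; apply/integrableP; split; [exact/measurable_EFinP| |exact/measurable_EFinP|];
  apply: le_lt_trans fy; apply: ge0_le_integral => //.
- by apply: measurableT_comp => //; exact/measurable_EFinP.
- exact/measurable_EFinP.
- by move=> x _; rewrite lee_fin normr_Re_le_normc.
- by apply: measurableT_comp => //; exact/measurable_EFinP.
- exact/measurable_EFinP.
- by move=> x _; rewrite lee_fin normr_Im_le_normc.
Qed.

Lemma cintegral_linear D (a : R[i]) f g : measurable D ->
  cintegrable D f -> cintegrable D g ->
  cintegral D (fun x => a * f x + g x) = a * cintegral D f + cintegral D g.
Proof.
move=> mD /(cintegrable_Re_Im mD)[fr fi] /(cintegrable_Re_Im mD)[gr gi].
case: a => a b; rewrite /cintegral /=.
have lin (s t : R) (p q r : R -> R) : mu.-integrable D (EFin \o p) ->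
    mu.-integrable D (EFin \o q) -> mu.-integrable D (EFin \o r) ->
    \int[mu]_(x in D) (s * p x + t * q x + r x) =
    s * (\int[mu]_(x in D) p x) + t * (\int[mu]_(x in D) q x) + \int[mu]_(x in D) r x.
  move=> ip iq ir.
  have isp : mu.-integrable D (EFin \o (fun x => s * p x)).
    exact: (integrableZl (mu := mu) mD s ip).
  have itq : mu.-integrable D (EFin \o (fun x => t * q x)).
    exact: (integrableZl (mu := mu) mD t iq).
  have ist : mu.-integrable D (EFin \o (fun x => s * p x + t * q x)).
    exact: (integrableD (mu := mu) mD isp itq).
  rewrite (RintegralD (mu := mu) mD ist ir) (RintegralD (mu := mu) mD isp itq).
  by rewrite (RintegralZl (mu := mu) _ mD ip) (RintegralZl (mu := mu) _ mD iq).
congr (_ +i* _).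
- rewrite -mulNr -(lin a (- b) _ _ _ fr fi gr).
  apply: eq_Rintegral => x _; case: (f x) => ? ?; case: (g x) => ? ? /=.
  by rewrite mulNr.
- rewrite -(lin a b _ _ _ fi fr gi).
  by apply: eq_Rintegral => x _; case: (f x) => ? ?; case: (g x) => ? ? /=.
Qed.

Lemma cintegralZl D (a : R[i]) f : measurable D -> cintegrable D f ->
  cintegral D (fun x => a * f x) = a * cintegral D f.
Proof.
move=> mD fD; have cint0 : cintegrable D (fun=> 0 : R[i]).
  split; first exact: cmeasurable_cst.
  by rewrite integral0_eq ?ltry// => x _; rewrite normc0.
have int0 : cintegral D (fun=> 0 : R[i]) = 0.
  by rewrite /cintegral /Rintegral/= !integral0_eq.
have := cintegral_linear a mD fD cint0; rewrite int0 addr0 => <-.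
by congr cintegral; apply/funext => x; rewrite addr0.
Qed.

Lemma ae_eq_cintegral D f g : measurable D -> cmeasurable D f -> cmeasurable D g ->
  ae_eq mu D f g -> cintegral D f = cintegral D g.
Proof.
move=> mD [fr fi] [gr gi] fg; rewrite /cintegral /Rintegral.
congr (fine _ +i* fine _); apply: ae_eq_integral => //.
- exact/measurable_EFinP.
- exact/measurable_EFinP.
- exact: (ae_eq_comp (fun z => (complex.Re z)%:E) fg).
- exact/measurable_EFinP.
- exact/measurable_EFinP.
- exact: (ae_eq_comp (fun z => (complex.Im z)%:E) fg).
Qed.

Lemma L2normE f : L2norm f = sqrte (integral_sq Rpos f).
Proof.
rewrite /L2norm unlock -poweR12_sqrt; last first.
  by apply: integral_ge0 => x _; rewrite lee_fin sqr_ge0.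
congr (_ `^ _)%E; rewrite /integral_sq [RHS]integral_mkcond.
apply: eq_integral => x _; rewrite /patch /=.
case: (x \in Rpos).
  by rewrite /= ger0_norm ?normc_ge0// powR_mulrn// normc_ge0.
by rewrite (_ : point = 0%:E :> \bar R)// abse0 poweR0r// pnatr_eq0.
Qed.

Lemma integral_sq_ge0 D f : (0 <= integral_sq D f)%E.
Proof. by apply: integral_ge0 => x _; rewrite lee_fin sqr_ge0. Qed.

Lemma L2norm_lty f : (L2norm f < +oo)%E = (integral_sq Rpos f < +oo)%E.
Proof.
rewrite L2normE; have := integral_sq_ge0 Rpos f.
by case: (integral_sq Rpos f) => [r| |]//= _; rewrite !ltry.
Qed.

Lemma le_L2norm (f g : R -> R[i]) (C : R) : 0 <= C ->
  (L2norm f <= C%:E * L2norm g)%E <->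
  (integral_sq Rpos f <= (C ^+ 2)%:E * integral_sq Rpos g)%E.
Proof.
move=> C0; rewrite !L2normE.
have -> : (C%:E = sqrte (C ^+ 2)%:E)%E by rewrite /= sqrtr_sqr ger0_norm.
rewrite -sqrteM ?lee_fin ?sqr_ge0// lee_sqrt//.
by rewrite mule_ge0 ?integral_sq_ge0// lee_fin sqr_ge0.
Qed.
End complex_integral.

(** * Operators whose kernel is dominated by u(max(x, y)) *)

Section kernel_operator.
Variables (R : realType) (u : R -> R) (A : R) (K : R -> R -> R[i]).
Notation mu := (@lebesgue_measure R).
Hypothesis u0 : forall x, 0 <= u x.
Hypothesis mfu : measurable_fun Rpos u.
Hypothesis uA : tail_bounded u A.
Hypothesis mKr : measurable_fun (@Rpos R `*` @Rpos R) (fun z => complex.Re (K z.1 z.2)).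
Hypothesis mKi : measurable_fun (@Rpos R `*` @Rpos R) (fun z => complex.Im (K z.1 z.2)).
Hypothesis Ku : forall x y, 0 < x -> 0 < y -> normc (K x y) <= u (Num.max x y).
Local Hint Extern 0 (measurable Rpos) => solve [exact: measurable_Rpos] : core.

Definition kernel_operator (f : R -> R[i]) (x : R) : R[i] :=
  cintegral Rpos (fun y => K x y * f y).

Lemma cmeasurable_kernel_section x : 0 < x -> cmeasurable Rpos (K x).
Proof.
move=> x0; split.
  exact: (measurable_fun_sectionl measurable_Rpos measurable_Rpos mKr x0).
exact: (measurable_fun_sectionl measurable_Rpos measurable_Rpos mKi x0).
Qed.

Lemma integral_normc_kernel_le x f : 0 < x -> cmeasurable Rpos f ->
  (\int[mu]_(y in Rpos) (normc (K x y * f y))%:E <=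
   \int[mu]_(y in Rpos) (u (Num.max x y) * normc (f y))%:E)%E.
Proof.
move=> x0 mf; apply: ge0_le_integral => //.
- by move=> y _; rewrite lee_fin normc_ge0.
- apply/measurable_EFinP; apply: cmeasurable_normc.
  exact: cmeasurableM (cmeasurable_kernel_section x0) mf.
- apply/measurable_EFinP; apply: measurable_funM.
    exact: (measurable_fun_sectionl measurable_Rpos measurable_Rpos
      (measurable_fun_max_kernel mfu) x0).
  exact: cmeasurable_normc.
- by move=> y y0; rewrite lee_fin normcM ler_wpM2r ?normc_ge0// Ku.
Qed.

(** A product of two L2 functions of y: were its integral infinite, Cauchy-Schwarz
    would make a product of two finite numbers infinite. *)
Lemma cintegrable_kernel x f : 0 < x -> inL2 f ->
  cintegrable Rpos (fun y => K x y * f y).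
Proof.
move=> x0 [mf]; rewrite L2norm_lty => fy.
split; first exact: cmeasurableM (cmeasurable_kernel_section x0) mf.
apply: le_lt_trans (integral_normc_kernel_le x0 mf) _.
have mux : measurable_fun Rpos (fun y => u (Num.max x y)).
  exact: (measurable_fun_sectionl measurable_Rpos measurable_Rpos
    (measurable_fun_max_kernel mfu) x0).
have := cauchy_schwarz_integral mu measurable_Rpos mux (cmeasurable_normc mf).
have -> : (\int[mu]_(y in Rpos) (`|u (Num.max x y) * normc (f y)|)%:E =
    \int[mu]_(y in Rpos) (u (Num.max x y) * normc (f y))%:E)%E.
  by apply: eq_integral => y _; rewrite ger0_norm// mulr_ge0 ?normc_ge0.
move=> cs; rewrite ltey; apply/eqP => E; move: cs; rewrite E.
rewrite expe2 mulyy leye_eq => /eqP.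
have : (\int[mu]_(y in Rpos) (u (Num.max x y) ^+ 2)%:E * integral_sq Rpos f < +oo)%E.
  apply: lte_mul_pinfty => //.
  - by apply: integral_ge0 => y _; rewrite lee_fin sqr_ge0.
  - rewrite fin_real// (lt_le_trans (ltNyr 0))/=; last first.
      by apply: integral_ge0 => y _; rewrite lee_fin sqr_ge0.
    exact: integral_sqr_max_kernel_lty uA _ x0.
by rewrite /integral_sq => + E2; rewrite E2.
Qed.

Lemma cmeasurable_kernel_operator f : cmeasurable Rpos f ->
  cmeasurable Rpos (kernel_operator f).
Proof.
move=> [fr fi]; have mX : measurable (@Rpos R `*` @Rpos R) by exact: measurableX.
have c2r : measurable_fun (@Rpos R `*` @Rpos R) (fun z => complex.Re (f z.2)).
  exact: (measurable_fun_comp_snd measurable_Rpos fr).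
have c2i : measurable_fun (@Rpos R `*` @Rpos R) (fun z => complex.Im (f z.2)).
  exact: (measurable_fun_comp_snd measurable_Rpos fi).
split; rewrite /kernel_operator /cintegral /=.
- apply: (measurable_fun_Rintegral_section mu (F := fun z => complex.Re (K z.1 z.2 * f z.2))) => //.
  under eq_fun do rewrite complex_ReM.
  by apply: measurable_funB; apply: measurable_funM.
- apply: (measurable_fun_Rintegral_section mu (F := fun z => complex.Im (K z.1 z.2 * f z.2))) => //.
  under eq_fun do rewrite complex_ImM.
  by apply: measurable_funD; apply: measurable_funM.
Qed.

Lemma integral_sq_kernel_operator_le f : cmeasurable Rpos f ->
  (integral_sq Rpos (kernel_operator f) <=
   ((2 * (4 + 4 * A)) ^+ 2)%:E * integral_sq Rpos f)%E.
Proof.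
move=> mf; have mT := cmeasurable_kernel_operator mf.
pose H x := (\int[mu]_(y in Rpos) (u (Num.max x y) * normc (f y))%:E)%E.
have H0 x : (0 <= H x)%E.
  by apply: integral_ge0 => y _; rewrite lee_fin mulr_ge0 ?normc_ge0.
have mH : measurable_fun Rpos H.
  apply: (ge0_measurable_fun_integrall mu measurable_Rpos measurable_Rpos
    (F := fun z => (u (Num.max z.1 z.2) * normc (f z.2))%:E)).
  - apply/measurable_EFinP; apply: measurable_funM.
      exact: measurable_fun_max_kernel.
    exact: (measurable_fun_comp_snd measurable_Rpos (cmeasurable_normc mf)).
  - by move=> x y _ _; rewrite lee_fin mulr_ge0 ?normc_ge0.
have mH2 : measurable_fun Rpos (fun x => H x ^+ 2)%E.
  by rewrite [X in measurable_fun _ X](_ : _ = (H \* H)%E); [exact: emeasurable_funM|].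
apply: (@le_trans _ _ (4%:E * \int[mu]_(x in Rpos) (H x ^+ 2))%E).
  rewrite -ge0_integralZl_EFin//; last by move=> x _; exact: expe_ge0.
  apply: ge0_le_integral => //.
  - by move=> x _; rewrite lee_fin sqr_ge0.
  - apply/measurable_EFinP; apply: measurable_funX; exact: cmeasurable_normc.
  - exact: measurable_funeM.
  - move=> x x0; have mKf := cmeasurableM (cmeasurable_kernel_section x0) mf.
    have le1 := normc_cintegral_le measurable_Rpos mKf.
    have le2 : ((normc (kernel_operator f x))%:E <= 2%:E * H x)%E.
      apply: le_trans le1 _; apply: lee_wpmul2l; first by rewrite lee_fin.
      exact: integral_normc_kernel_le.
    rewrite EFin_expe !expe2 (_ : 4%:E = 2%:E * 2%:E)%E; last first.
      by rewrite -EFinM -natrM.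
    by rewrite muleACA; apply: lee_pmul => //; rewrite lee_fin normc_ge0.
apply: (@le_trans _ _ (4%:E * (((4 + 4 * A) ^+ 2)%:E * integral_sq Rpos f))%E).
  apply: lee_wpmul2l; first by rewrite lee_fin.
  apply: (max_kernel_bound u0 mfu uA) => //; first exact: cmeasurable_normc.
  by move=> y; exact: normc_ge0.
rewrite muleA -EFinM (_ : 4 * (4 + 4 * A) ^+ 2 = (2 * (4 + 4 * A)) ^+ 2)//.
by ring.
Qed.

(** Since the integrals converge absolutely at each x > 0, linearity and
    compatibility with a.e. equality hold pointwise, and only the norm bound uses
    the Schur test. *)
Lemma kernel_operator_bounded : L2_bounded_operator kernel_operator.
Proof.
have C0 : 0 <= 2 * (4 + 4 * A).
  by rewrite mulr_ge0// addr_ge0// mulr_ge0// (tail_bound_ge0 uA).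
split.
- move=> f [mf]; rewrite L2norm_lty => fy; split; first exact: cmeasurable_kernel_operator.
  rewrite L2norm_lty; apply: le_lt_trans (integral_sq_kernel_operator_le mf) _.
  by apply: lte_mul_pinfty => //; rewrite lee_fin sqr_ge0.
- move=> f g [mf _] [mg _] fg; apply/aeW => x x0.
  apply: (ae_eq_cintegral measurable_Rpos).
  + exact: cmeasurableM (cmeasurable_kernel_section x0) mf.
  + exact: cmeasurableM (cmeasurable_kernel_section x0) mg.
  + by move: fg; apply: filterS => y fgy y0; rewrite fgy.
- move=> a f g fL gL; apply/aeW => x x0.
  rewrite /kernel_operator -(cintegral_linear _ measurable_Rpos); try exact: cintegrable_kernel.
  congr cintegral; apply/funext => y.
  by rewrite mulrDr mulrCA.
- exists (2 * (4 + 4 * A)) => f [mf _].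
  apply/le_L2norm => //; exact: integral_sq_kernel_operator_le.
Qed.

End kernel_operator.

(** * Necessity of the tail condition *)

Section necessity.
Variables (R : realType) (b : R).
Notation mu := (@lebesgue_measure R).
Hypothesis b0 : 0 < b.
Local Hint Extern 0 (measurable Rpos) => solve [exact: measurable_Rpos] : core.

Let I : set R := `[b / 2, b]%classic.

(** Any support [c b, b] with 0 < c < 1 would serve: its length is comparable to b,
    and it is compact in the open half-line. *)
Definition bump (x : R) : R[i] := (\1_I x)%:C.

Lemma measurable_bump_support : default_measure_display.-measurable I.
Proof. exact: measurable_itv. Qed.

Lemma bump_support_pos : I `<=` Rpos.
Proof.
move=> x; rewrite /I/= in_itv/= => /andP[+ _]; apply: lt_le_trans.
by rewrite divr_gt0.
Qed.

Lemma measure_bump_support : mu I = (b / 2)%:E.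
Proof.
rewrite lebesgue_measure_itv/= lte_fin ifT; last by rewrite ltr_pdivrMr// ltr_pMr// ltr1n.
by rewrite -EFinB; congr EFin; field.
Qed.

Lemma normc_bump x : normc (bump x) = \1_I x.
Proof. by rewrite /bump /normc/= expr0n addr0 sqrtr_sqr ger0_norm// indicE. Qed.

Lemma cmeasurable_bump D : default_measure_display.-measurable D -> cmeasurable D bump.
Proof.
by move=> mD; split => /=; [exact: measurable_indic measurable_bump_support|exact: measurable_cst].
Qed.

Lemma test_fun_bump : test_fun bump.
Proof.
split; first exact: cmeasurable_bump measurable_Rpos.
- by exists 1 => x _; rewrite normc_bump indicE lern1 leq_b1.
- exists I; first by split; [exact: segment_compact|exact: bump_support_pos].
  by move=> x _ Ix; rewrite /bump indicE memNset.
Qed.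

Lemma integral_sq_bump : integral_sq Rpos bump = (b / 2)%:E.
Proof.
rewrite -measure_bump_support -(setIidl bump_support_pos).
rewrite -integral_indic//; last exact: measurable_bump_support.
apply: eq_integral => x _; rewrite normc_bump indicE.
by case: (_ \in _); rewrite ?expr0n ?expr1n.
Qed.

Lemma inL2_bump : inL2 bump.
Proof.
split; first exact: cmeasurable_bump measurable_Rpos.
by rewrite L2norm_lty integral_sq_bump ltry.
Qed.

Lemma cintegrable_bump D : default_measure_display.-measurable D -> cintegrable D bump.
Proof.
move=> mD; split; first exact: cmeasurable_bump.
under eq_integral do rewrite normc_bump.
rewrite integral_indic//; last exact: measurable_bump_support.
apply: (@le_lt_trans _ _ (mu I)); last by rewrite measure_bump_support ltry.
by apply: le_measure; rewrite ?inE//; [apply: measurableI => //|]; exact: measurable_bump_support.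
Qed.

Lemma cintegral_bump D : default_measure_display.-measurable D -> I `<=` D ->
  cintegral D bump = (b / 2)%:C.
Proof.
move=> mD ID; rewrite /cintegral /Rintegral /=.
rewrite integral_indic//; last exact: measurable_bump_support.
rewrite (setIidl ID) integral0_eq//.
by transitivity (fine (mu I) +i* 0); [|rewrite measure_bump_support].
Qed.

Variables (phi : R -> R[i]) (mphi : cmeasurable Rpos phi).
Variables (Op : (R -> R[i]) -> R -> R[i]).
Hypothesis OpE : forall x, b < x -> Op bump x = phi x * (b / 2)%:C.

(** On ]b, +oo[ the image of the bump is phi * b/2, so the part of its norm carried
    by ]b, +oo[ is the tail of phi up to the factor (b/2)^2. *)
Lemma tail_le_of_bump_bound (T : (R -> R[i]) -> R -> R[i]) (C : R) : 0 <= C ->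
  cmeasurable Rpos (T bump) -> ae_eq mu Rpos (T bump) (Op bump) ->
  (L2norm (T bump) <= C%:E * L2norm bump)%E ->
  (b%:E * \int[mu]_(t in `[b, +oo[) (normc (phi t) ^+ 2)%:E <= (2 * C ^+ 2)%:E)%E.
Proof.
move=> C0 mT TOp; rewrite le_L2norm// integral_sq_bump => bnd.
have sub : `]b, +oo[%classic `<=` @Rpos R.
  by move=> x/=; rewrite in_itv/= andbT; exact: lt_trans.
have mb : measurable `]b, +oo[%classic by exact: measurable_itv.
have mphi2 : measurable_fun `]b, +oo[%classic (fun t => (normc (phi t) ^+ 2)%:E).
  apply/measurable_EFinP; apply: measurable_funX; apply: cmeasurable_normc.
  exact: cmeasurableS measurable_Rpos sub mphi.
have mT2 : measurable_fun Rpos (fun t => (normc (T bump t) ^+ 2)%:E).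
  apply/measurable_EFinP; apply: measurable_funX; exact: cmeasurable_normc.
have bb : 0 < b / 2 by rewrite divr_gt0.
have key : (((b / 2) ^+ 2)%:E * \int[mu]_(t in `]b, +oo[) (normc (phi t) ^+ 2)%:E <=
    (C ^+ 2 * (b / 2))%:E)%E.
  apply: le_trans bnd.
  rewrite -ge0_integralZl_EFin ?sqr_ge0//; last first.
    by move=> t _; rewrite lee_fin sqr_ge0.
  apply: (@le_trans _ _ (\int[mu]_(t in `]b, +oo[) (normc (T bump t) ^+ 2)%:E)%E).
    rewrite le_eqVlt; apply/orP; left; apply/eqP; apply: ge0_ae_eq_integral => //.
    - exact: measurable_funeM.
    - exact: measurable_funS mT2.
    - by move=> t _; rewrite -EFinM lee_fin mulr_ge0 ?sqr_ge0.
    - by move=> t _; rewrite lee_fin sqr_ge0.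
    - move: TOp; apply: filterS => t Tt bt; rewrite (Tt (sub _ bt)) OpE; last first.
        by move: bt; rewrite /= in_itv/= andbT.
      rewrite -EFinM; congr EFin; rewrite normcM [RHS]exprMn mulrC; congr (_ * _).
      by rewrite /normc/= expr0n addr0 sqrtr_sqr (ger0_norm (ltW bb)).
  apply: ge0_subset_integral => //.
  by move=> t _; rewrite lee_fin sqr_ge0.
rewrite -integral_itv_obnd_cbnd//.
(* b/4 * b = (b/2)^2 matches the left-hand side of key. *)
rewrite -(@lee_pmul2l _ (b / 4)%:E)//; last by rewrite lte_fin divr_gt0.
rewrite muleA -EFinM -EFinM.
apply: le_trans (le_trans key _).
  by rewrite (_ : b / 4 * b = (b / 2) ^+ 2)//; field.
by rewrite lee_fin le_eqVlt; apply/orP; left; apply/eqP; field.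
Qed.
End necessity.

Lemma tail_bound_of_bounded (R : realType) (phi : R -> R[i])
    (Op : (R -> R[i]) -> R -> R[i]) :
  cmeasurable Rpos phi ->
  (forall b, 0 < b -> forall x, b < x -> Op (bump b) x = phi x * (b / 2)%:C) ->
  bounded_on_L2 Op ->
  exists A : R, tail_bounded (fun t => normc (phi t)) A.
Proof.
move=> mphi OpE [T [TL2 _ _ [C TC]] TE].
(* The constant C of a bounded operator may be negative. *)
exists (2 * `|C| ^+ 2) => y y0.
have [mTb _] := TL2 _ (inL2_bump y0).
apply: (tail_le_of_bump_bound y0 mphi (OpE _ y0) _ mTb (TE _ (test_fun_bump y0))) => //.
apply: le_trans (TC _ (inL2_bump y0)) _.
by apply: lee_wpmul2r; [rewrite L2normE sqrte_ge0|rewrite lee_fin ler_norm].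
Qed.

(** * The dyadic form of the tail condition *)

Section dyadic.
Variables (R : realType) (phi : R -> R[i]).
Notation mu := (@lebesgue_measure R).
Hypothesis mphi : cmeasurable Rpos phi.

Let mphi2 (D : set R) : default_measure_display.-measurable D -> D `<=` Rpos ->
  measurable_fun D (fun t => (normc (phi t) ^+ 2)%:E).
Proof.
move=> mD DR; apply/measurable_EFinP; apply: measurable_funX.
apply: cmeasurable_normc; exact: cmeasurableS measurable_Rpos DR mphi.
Qed.

Let phi20 t : (0 <= (normc (phi t) ^+ 2)%:E)%E.
Proof. by rewrite lee_fin sqr_ge0. Qed.

Lemma exists_dyadic_bounds (y : R) : 0 < y ->
  exists n : int, (2 : R) ^ n <= y <= 2 ^ (n + 1).
Proof.
move=> y0; have [y1|y1] := leP 1 y.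
  have [k /andP[k1 k2]] := exists_expn_shell (isT : (1 < 2)%N) y1.
  by exists k%:Z; rewrite k1/= -PoszD addn1 ltW.
have yV1 : 1 <= y^-1 by rewrite invf_ge1// ltW.
have [k /andP[k1 k2]] := exists_expn_shell (isT : (1 < 2)%N) yV1.
have y20 j : 0 < (2 : R) ^+ j by rewrite exprn_gt0.
exists (- k.+1%:Z); rewrite (_ : - k.+1%:Z + 1 = - k%:Z); last first.
  by rewrite -addn1 PoszD opprD addrK.
rewrite -!exprnN -[y]invrK !lef_pV2 ?posrE ?invr_gt0//.
by rewrite k1 andbT ltW.
Qed.

(** If 2^N <= y <= 2^(N+1), the shells from 2^N on cover [y, +oo[ and contribute at
    most M / 2^(N+k) each, hence 2 M / 2^N <= 4 M / y in total. *)
Lemma tail_bound_of_Xinfty : Xinfty phi ->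
  exists A : R, tail_bounded (fun t => normc (phi t)) A.
Proof.
move=> [_]; set S := ereal_sup _ => Soo.
have Sub (n : int) : (((2 : R) ^ n)%:E * integral_sq `](2 ^ n), (2 ^ (n + 1))[ phi <= S)%E.
  by apply: ereal_sup_ubound; exists n.
have p2 (n : int) : (0 < (2 : R) ^ n) by rewrite exprz_gt0.
have S0 : (0 <= S)%E.
  by apply: le_trans (Sub 0); rewrite mule_ge0 ?lee_fin ?(ltW (p2 _))// integral_sq_ge0.
pose M := fine S; have SM : S = M%:E by rewrite fineK// ge0_fin_numE.
exists (4 * M) => y y0; have [N /andP[Ny yN]] := exists_dyadic_bounds y0.
(* Left-closed shells cover the half-line; they carry the same integrals as the
   open ones. *)
pose F k : set R := `[2 ^ (N + k%:Z), 2 ^ (N + k%:Z + 1)[%classic.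
have mFk k : default_measure_display.-measurable (F k) by exact: measurable_itv.
have mF : default_measure_display.-measurable (\bigcup_k F k) by exact: bigcup_measurable.
have FR : \bigcup_k F k `<=` Rpos.
  by move=> t [k _]; rewrite /F/= in_itv/= => /andP[+ _]; apply: lt_le_trans.
have cover : `[y, +oo[%classic `<=` \bigcup_k F k.
  move=> t/=; rewrite in_itv/= andbT => yt.
  have t1 : 1 <= t / 2 ^ N by rewrite ler_pdivlMr// mul1r (le_trans Ny).
  have [k /andP[k1 k2]] := exists_expn_shell (isT : (1 < 2)%N) t1.
  exists k => //; rewrite /F/= in_itv/= -addrA -PoszD addn1 !expfzDr ?pnatr_eq0//.
  by rewrite mulrC -ler_pdivlMr// k1/= mulrC -ltr_pdivrMr.
have bound : (\int[mu]_(t in \bigcup_k F k) (normc (phi t) ^+ 2)%:E <= (2 * (M / 2 ^ N))%:E)%E.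
  apply: ge0_integral_bigcup_geometric => // [|k]; first exact: mphi2.
  rewrite /F integral_itv_bndoo; last first.
    apply: mphi2; first exact: measurable_itv.
    by move=> t/=; rewrite in_itv/= => /andP[+ _]; apply: lt_trans.
  have := Sub (N + k%:Z); rewrite SM -lee_pdivlMl// => /le_trans; apply.
  rewrite -EFinM lee_fin expfzDr ?pnatr_eq0// invfM.
  by rewrite -[2 ^ k%:Z]/(2 ^+ k) mulrC mulrA.
apply: (@le_trans _ _ ((2 ^ (N + 1))%:E * (2 * (M / 2 ^ N))%:E)%E).
  apply: lee_pmul => //.
  - by rewrite lee_fin ltW.
  - exact: integral_ge0.
  apply: le_trans bound; apply: ge0_subset_integral.
  - exact: measurable_itv.
  - exact: mF.
  - exact: mphi2.
  - by [].
  - exact: cover.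
rewrite -EFinM lee_fin expfzDr ?pnatr_eq0// expr1z.
rewrite le_eqVlt; apply/orP; left; apply/eqP; field.
by rewrite gt_eqF.
Qed.

Lemma Xinfty_of_tail_bound (A : R) :
  tail_bounded (fun t => normc (phi t)) A -> Xinfty phi.
Proof.
move=> phiA; split=> //; apply: (@le_lt_trans _ _ A%:E); last exact: ltry.
apply: ge_ereal_sup => _ [n _ <-].
have p2 (m : int) : (0 < (2 : R) ^ m) by rewrite exprz_gt0.
apply: le_trans (phiA _ (p2 n)); apply: lee_wpmul2l; first by rewrite lee_fin ltW.
apply: ge0_subset_integral.
- exact: measurable_itv.
- exact: measurable_itv.
- apply: mphi2; first exact: measurable_itv.
  by move=> t/=; rewrite in_itv/= andbT; exact: lt_le_trans.
- by [].
- by move=> t/=; rewrite !in_itv/= andbT => /andP[/ltW].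
Qed.
End dyadic.

(** * The two operators *)

Section operators.
Variables (R : realType) (phi : R -> R[i]) (A : R).
Notation mu := (@lebesgue_measure R).
Hypothesis mphi : cmeasurable Rpos phi.

Section bump_images.
Variables (b x : R).
Hypotheses (b0 : 0 < b) (bx : b < x).

Lemma Q_bump : Q phi (bump b) x = phi x * (b / 2)%:C.
Proof.
rewrite -(cintegral_bump b0 measurable_Rpos (bump_support_pos b0)).
rewrite -cintegralZl; [|exact: measurable_Rpos|exact: cintegrable_bump measurable_Rpos].
rewrite /Q; congr cintegral; apply/funext => y.
rewrite /bump indicE; case: (boolP (y \in _)) => [|_]; last by rewrite !mulr0.
by rewrite inE/= in_itv/= => /andP[_ yb]; rewrite max_l ?(le_trans yb (ltW bx)).
Qed.

Lemma Qplus_bump : Qplus phi (bump b) x = phi x * (b / 2)%:C.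
Proof.
rewrite /Qplus (cintegral_bump b0)//.
move=> y/=; rewrite !in_itv/= => /andP[ylb yb].
by rewrite (lt_le_trans _ ylb) ?divr_gt0// (le_lt_trans yb bx).
Qed.
End bump_images.

Hypothesis phiA : tail_bounded (fun t => normc (phi t)) A.

Lemma Q_bounded : bounded_on_L2 (Q phi).
Proof.
exists (kernel_operator (fun x y => phi (Num.max x y))); last first.
  by move=> f _; exact: ae_eq_refl.
have [pr pi] := mphi.
apply: (kernel_operator_bounded _ _ phiA) => //.
- by move=> x; exact: normc_ge0.
- exact: cmeasurable_normc.
- exact: (measurable_fun_max_kernel pr).
- exact: (measurable_fun_max_kernel pi).
Qed.

Definition Qplus_kernel (x y : R) : R[i] := if y < x then phi x else 0.

(** The factor phi(x) enters the integral by linearity, which needs f integrable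
    on ]0, x[; a test function is bounded there. *)
Lemma kernel_operator_Qplus f x : test_fun f -> 0 < x ->
  kernel_operator Qplus_kernel f x = Qplus phi f x.
Proof.
move=> [mf [M fM] _] x0.
have sub : `]0, x[%classic `<=` @Rpos R.
  by move=> y/=; rewrite in_itv/= => /andP[].
have mI : default_measure_display.-measurable (`]0, x[%classic : set R) by exact: measurable_itv.
have mfI : cmeasurable `]0, x[ f by exact: cmeasurableS measurable_Rpos sub mf.
have fI : cintegrable `]0, x[ f.
  split; [exact: mfI|].
  apply: (@le_lt_trans _ _ (\int[mu]_(y in `]0%R, x[) M%:E)%E).
    apply: ge0_le_integral => //.
    - by move=> y _; rewrite lee_fin normc_ge0.
    - by apply/measurable_EFinP; exact: cmeasurable_normc.
    - by move=> y /sub y0; rewrite lee_fin fM.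
  rewrite integral_cst//= lebesgue_measure_itv/= lte_fin x0 -EFinD -EFinM.
  exact: ltry.
rewrite /Qplus -cintegralZl// /kernel_operator /cintegral.
have IE : `]0, x[%classic = Rpos `&` `]-oo, x[%classic :> set R.
  apply/seteqP; split => y /=; rewrite /Rpos/= !in_itv/=; first by move/andP.
  by move=> [-> ->].
rewrite IE; congr (_ +i* _); rewrite [RHS]Rintegral_mkcondr; apply: eq_Rintegral => y _.
- rewrite /patch mem_setE in_itv/= /Qplus_kernel; case: ifP => // _.
  by rewrite mul0r.
- rewrite /patch mem_setE in_itv/= /Qplus_kernel; case: ifP => // _.
  by rewrite mul0r.
Qed.

Lemma Qplus_bounded : bounded_on_L2 (Qplus phi).
Proof.
exists (kernel_operator Qplus_kernel); last first.
  by move=> f tf; apply/aeW => x x0; exact: kernel_operator_Qplus.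
have [pr pi] := mphi.
have mX : measurable (@Rpos R `*` @Rpos R) by exact: measurableX measurable_Rpos measurable_Rpos.
have mpart (p : R -> R) : measurable_fun Rpos p ->
    measurable_fun (@Rpos R `*` @Rpos R) (fun z => if z.2 < z.1 then p z.1 else 0).
  move=> mp; apply: measurable_fun_if => //.
  - by apply: measurable_fun_ltr; apply: measurable_funTS;
      [exact: measurable_snd|exact: measurable_fst].
  - apply: (@measurable_funS _ _ _ _ (@Rpos R `*` @Rpos R)) => //.
    exact: (measurable_fun_comp_fst measurable_Rpos mp).
apply: (kernel_operator_bounded _ _ phiA).
- by move=> x; exact: normc_ge0.
- exact: cmeasurable_normc.
- under eq_fun do rewrite /Qplus_kernel (fun_if (@complex.Re R)).
  exact: (mpart _ pr).
- under eq_fun do rewrite /Qplus_kernel (fun_if (@complex.Im R)).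
  exact: (mpart _ pi).
- move=> x y x0 y0; rewrite /Qplus_kernel; case: ifP => yx; last by rewrite normc0 normc_ge0.
  by rewrite max_l// ltW.
Qed.
End operators.

Theorem theorem3p1 (R : realType) (phi : R -> R[i]%C) :
  L2loc phi ->
  [<-> bounded_on_L2 (Q phi); bounded_on_L2 (Qplus phi); Xinfty phi].
Proof.
move=> [mphi _]; tfae.
- move=> /(tail_bound_of_bounded mphi) [b b0 x bx|A phiA]; first exact: Q_bump.
  exact: Qplus_bounded phiA.
- move=> /(tail_bound_of_bounded mphi) [b b0 x bx|A phiA]; first exact: Qplus_bump.
  exact: Xinfty_of_tail_bound phiA.
- by move=> /(tail_bound_of_Xinfty mphi) [A phiA]; exact: Q_bounded phiA.
Qed.
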